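(* Let $a\in\mathbb R$, $\lambda>0$ with $|a|<\lambda$. There exists a (sufficiently small) constant $\theta_0=\theta_0(a,\lambda)\in(0,1)$ such that the following holds. Let $\varepsilon,\Delta x,\Delta t,T>0$, $\sigma=\Delta t/\Delta x$, and assume $\lambda\sigma\le\theta_0$. Let $(\mathbf U_j^n)_{j\in\mathbb Z,n\in\mathbb N}$, $\mathbf U_j^n=(u_j^n,v_j^n)^\top$, be generated by the Lie splitting scheme, let $(\bar u_j^n)_{j\in\mathbb Z,n\in\mathbb N}$ be a solution of the limiting scheme (both schemes are given in the context), and set $\bar{\mathbf U}_j^n=(\bar u_j^n,a\bar u_j^n)^\top$, $w_j^n=v_j^n-au_j^n$. Assume: - $\Phi_{\mathrm{rel}}^0<+\infty$; - there exist two constant equilibrium states $\mathbf U_\pm$ (i.e. of the form $(u_\pm,au_\pm)^\top$) such that for every $n\in\mathbb N$, $\lim_{j\to\pm\infty}\mathbf U_j^n=\mathbf U_\pm$ and $\lim_{j\to\pm\infty}\bar{\mathbf U}_j^n=\mathbf U_\pm$; - there exists $K>0$ such that for every $N\in\mathbb N$ with $N\Delta t\le T$, $$\sum_{n=0}^{N-1}\Delta t\,\Delta x\sum_{j\in\mathbb Z}\Bigl(\frac{\bar u_{j+1}^n-\bar u_j^n}{\Delta x}\Bigr)^2\le K^2 .$$ Then, for every $N\in\mathbb N$ with $N\Delta t\le T$, $$\Phi_{\mathrm{rel}}^N\le\Phi_{\mathrm{rel}}^0+\frac{\Delta t}{2\varepsilon}\,\Delta x\sum_{j\in\mathbb Z}(w_j^0)^2+\frac{\Delta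 t^2}{2\varepsilon^2}\,\Delta x\sum_{j\in\mathbb Z}(w_j^0)^2+\frac{\varepsilon(\lambda^2-a^2)^2}{2}K^2 .$$
   Context: Notation: $A=\begin{pmatrix}0&1\\\lambda^2&0\end{pmatrix}$, $H=\begin{pmatrix}\lambda^2&-a\\-a&1\end{pmatrix}$, $\mathbf F(\mathbf U)=A\mathbf U$, $\mathbf R(\mathbf U)=(0,\,au-v)^\top$ for $\mathbf U=(u,v)^\top$. Lie splitting scheme: for $j\in\mathbb Z$, $n\in\mathbb N$, $$\mathbf U_j^{n+\frac12}=\mathbf U_j^n-\sigma(\widehat{\mathbf F}_{j+\frac12}^n-\widehat{\mathbf F}_{j-\frac12}^n),\quad \widehat{\mathbf F}_{j+\frac12}^n=\tfrac12\bigl(\mathbf F(\mathbf U_j^n)+\mathbf F(\mathbf U_{j+1}^n)\bigr)-\tfrac\lambda2(\mathbf U_{j+1}^n-\mathbf U_j^n),$$ $$\mathbf U_j^{n+1}=\mathbf U_j^{n+\frac12}+\frac{\Delta t}{\varepsilon}\mathbf R(\mathbf U_j^{n+1}).$$ Limiting scheme: $$\bar u_j^{n+1}=\bar u_j^n-\sigma(\widehat f_{j+\frac12}^n-\widehat f_{j-\frac12}^n),\quad \widehat f_{j+\frac12}^n=\tfrac a2(\bar u_j^n+\bar u_{j+1}^n)-\tfrac\lambda2(\bar u_{j+1}^n-\bar u_j^n).$$ Global discrete relative entropy: $$\Phi_{\mathrm{rel}}^n=\frac{\Delta x}{2}\sum_{j\in\mathbb Z}(\mathbf U_j^n-\bar{\mathbf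 U}_j^n)^\top H(\mathbf U_j^n-\bar{\mathbf U}_j^n).$$ *)

(* Defs.v *)
From HB Require Import structures.
From mathcomp Require Import all_boot all_order all_algebra.
From mathcomp Require Import all_classical all_reals all_analysis.
Set Implicit Arguments.
Unset Strict Implicit.
Unset Printing Implicit Defensive.
Import Order.TTheory GRing.Theory Num.Theory.
Import numFieldNormedType.Exports.
Local Open Scope classical_set_scope.
Local Open Scope ring_scope.

Definition col2 (R : realType) (x y : R) : 'cV[R]_2 :=
  \col_(i < 2) [:: x; y]`_i.

Definition mx22 (R : realType) (a b c d : R) : 'M[R]_2 :=
  \matrix_(i < 2, j < 2) (nth [::] [:: [:: a; b]; [:: c; d]] i)`_j.

Definition ucomp (R : realType) (U : 'cV[R]_2) : R := U 0 0.
Definition vcomp (R : realType) (U : 'cV[R]_2) : R := U 1 0.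

Definition matA (R : realType) (lam : R) : 'M[R]_2 := mx22 0 1 (lam ^+ 2) 0.

Definition matH (R : realType) (a lam : R) : 'M[R]_2 :=
  mx22 (lam ^+ 2) (- a) (- a) 1.

Definition fluxF (R : realType) (lam : R) (U : 'cV[R]_2) : 'cV[R]_2 :=
  matA lam *m U.

Definition relaxR (R : realType) (a : R) (U : 'cV[R]_2) : 'cV[R]_2 :=
  col2 0 (a * ucomp U - vcomp U).

Definition equilibrium (R : realType) (a u : R) : 'cV[R]_2 := col2 u (a * u).

Definition wdev (R : realType) (a : R) (U : 'cV[R]_2) : R :=
  vcomp U - a * ucomp U.

(* The interface j + 1/2 is indexed by the integer j. *)
Definition num_flux_sys (R : realType) (lam : R) (U : int -> 'cV[R]_2) (j : int)
  : 'cV[R]_2 :=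
  (1 / 2) *: (fluxF lam (U j) + fluxF lam (U (j + 1)))
  - (lam / 2) *: (U (j + 1) - U j).

Definition half_step (R : realType) (lam sigma : R) (U : int -> 'cV[R]_2)
  (j : int) : 'cV[R]_2 :=
  U j - sigma *: (num_flux_sys lam U j - num_flux_sys lam U (j - 1)).

Definition lie_splitting (R : realType) (a lam eps dx dt : R)
  (U : nat -> int -> 'cV[R]_2) : Prop :=
  forall (n : nat) (j : int),
    U n.+1 j = half_step lam (dt / dx) (U n) j + (dt / eps) *: relaxR a (U n.+1 j).

Definition num_flux_lim (R : realType) (a lam : R) (u : int -> R) (j : int) : R :=
  a / 2 * (u j + u (j + 1)) - lam / 2 * (u (j + 1) - u j).

Definition limiting_scheme (R : realType) (a lam dx dt : R)
  (u : nat -> int -> R) : Prop :=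
  forall (n : nat) (j : int),
    u n.+1 j =
    u n j - dt / dx * (num_flux_lim a lam (u n) j - num_flux_lim a lam (u n) (j - 1)).

(* Sum over Z of a family of nonnegative terms, possibly +oo: [esum] is the
   supremum of the finite partial sums, hence meaningful only for such families. *)
Definition sumZ (R : realType) (f : int -> R) : \bar R :=
  \esum_(j in [set: int]) (f j)%:E.

Definition quad_form (R : realType) (H : 'M[R]_2) (X : 'cV[R]_2) : R :=
  (X^T *m H *m X) 0 0.

(* [matH a lam] is positive definite when |a| < lam, so [sumZ] applies. *)
Definition rel_entropy (R : realType) (a lam dx : R) (U V : int -> 'cV[R]_2)
  : \bar R :=
  ((dx / 2)%:E * sumZ (fun j => quad_form (matH a lam) (U j - V j)%R))%E.

(* Limits along j -> +oo and j -> -oo in Z, expressed on the cofinal copies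
   j and - j (j : nat). *)
Definition lim_pinfty (R : realType) (U : int -> 'cV[R]_2) (l : 'cV[R]_2) : Prop :=
  (fun j : nat => U j%:Z) @ \oo --> l.
Definition lim_ninfty (R : realType) (U : int -> 'cV[R]_2) (l : 'cV[R]_2) : Prop :=
  (fun j : nat => U (- j%:Z)) @ \oo --> l.

(* Main.v *)
Require Import Defs.
From HB Require Import structures.
From mathcomp Require Import all_boot all_order all_algebra.
From mathcomp Require Import all_classical all_reals all_analysis.
From mathcomp Require Import ring lra.
Set Implicit Arguments.
Unset Strict Implicit.
Unset Printing Implicit Defensive.
Import Order.TTheory GRing.Theory Num.Theory.
Import numFieldNormedType.Exports.
Local Open Scope classical_set_scope.
Local Open Scope ring_scope.

(** Write s = lam * dt / dx and t = dt / eps, and let E = (e, z) be the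
    difference between the state U and the equilibrium state (ubar, a ubar).

    The entropy density is diagonal in two systems of coordinates: with
    w = z - a e (which is also v - a u), it equals
    (lam^2 - a^2) e^2 + w^2 ([quad_formE]); in the Riemann invariants
    lam e + z and lam e - z it is a weighted sum of their squares, with
    weights (lam - a) / (2 lam) and (lam + a) / (2 lam), positive because
    |a| < lam ([quad_form_riemann]).

    One half step is upwind transport: each Riemann invariant at j becomes a
    convex combination, with weights 1 - s and s, of its values at two
    neighbouring cells ([riemann_right_half_step], [riemann_left_half_step]).
    By convexity of the square, transport does not increase the global entropy
    as soon as s <= 1.  Applied to an equilibrium state, the half step gives
    the first component of the limiting scheme exactly, but leaves the
    equilibrium manifold by the consistency defect
    - g_j, where g_j = (dt / (2 dx)) (lam^2 - a^2) (ubar_(j+1) - ubar_(j-1))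
    ([ucomp_half_step_equilibrium], [wdev_half_step_equilibrium]).

    The implicit relaxation step keeps e and turns the transported value w'
    of w into (w' - g_j) / (1 + t).  The damping absorbs the cross term:
    (w' - g)^2 / (1 + t)^2 <= w'^2 + g^2 / (2 t) ([square_relaxed_le]).
    Hence every time step increases the relative entropy by at most
    dx / 2 times the sum of g_j^2 / (2 t), which is controlled by the discrete
    gradient of ubar ([rel_entropy_step]).  Summing over the time steps gives
    [rel_entropy_le_sum], whose right-hand side is bounded through K; the terms
    with the initial deviation w^0 are nonnegative and are added for free.
    All the sums over the cells have nonnegative terms, so they may be split
    and shifted in the extended reals without any summability condition. *)

(** * Nonnegative sums over the integers *)

Lemma sumZ_ge0 (R : realType) (f : int -> R) :
  (forall j, 0 <= f j) -> (0 <= sumZ f)%E.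
Proof. by move=> f0; apply: esum_ge0 => j _; rewrite lee_fin. Qed.

Lemma le_sumZ (R : realType) (f g : int -> R) :
  (forall j, f j <= g j) -> (sumZ f <= sumZ g)%E.
Proof. by move=> fg; apply: le_esum => j _; rewrite lee_fin. Qed.

Lemma eq_sumZ (R : realType) (f g : int -> R) : f =1 g -> sumZ f = sumZ g.
Proof. by move=> /funext ->. Qed.

Lemma sumZD (R : realType) (f g : int -> R) :
  (forall j, 0 <= f j) -> (forall j, 0 <= g j) ->
  sumZ (fun j => f j + g j) = (sumZ f + sumZ g)%E.
Proof.
by move=> f0 g0; rewrite /sumZ -esumD => [|j _|j _]; rewrite ?lee_fin.
Qed.

Lemma sumZ_shift (R : realType) (f : int -> R) (k : int) :
  sumZ (fun j => f (j + k)) = sumZ f.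
Proof.
have bij : set_bij [set: int] [set: int] (fun j : int => j + k).
  split=> [j // |i j _ _ /addIr // |j _].
  by exists (j - k) => //; rewrite subrK.
exact/esym/(@reindex_esum _ _ _ _ _ _ (fun j => (f j)%:E) bij).
Qed.

Lemma sumZ_scale_le (R : realType) (c : R) (f : int -> R) :
  0 <= c -> (forall j, 0 <= f j) ->
  (sumZ (fun j => c * f j)%R <= c%:E * sumZ f)%E.
Proof.
move=> c0 f0; apply: ge_ereal_sup => _ [F fF <-].
under eq_fsbigr do rewrite EFinM.
rewrite -ge0_mule_fsumr => [|j]; last by rewrite lee_fin.
by apply: lee_wpmul2l; rewrite ?lee_fin//; apply: esum_ge; exists F.
Qed.

(** * Two inequalities on squares *)

(** The difference of the two sides is
    (t y + g)^2 + (2 t y + g)^2 / (2 t). *)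
Lemma square_relaxed_le (R : realFieldType) (t x y g : R) :
  0 < t -> (1 + t) * y = x - g -> y ^+ 2 <= x ^+ 2 + g ^+ 2 / (2 * t).
Proof.
move=> t0 yE; have -> : x = (1 + t) * y + g by rewrite yE subrK.
rewrite -subr_ge0.
have -> : ((1 + t) * y + g) ^+ 2 + g ^+ 2 / (2 * t) - y ^+ 2 =
    (t * y + g) ^+ 2 + (2 * t * y + g) ^+ 2 / (2 * t).
  by field; rewrite gt_eqF.
by rewrite addr_ge0 ?sqr_ge0// divr_ge0 ?sqr_ge0// mulr_ge0// ltW.
Qed.

Lemma square_convex_le (R : realFieldType) (s x y : R) :
  0 <= s <= 1 ->
  ((1 - s) * x + s * y) ^+ 2 <= (1 - s) * x ^+ 2 + s * y ^+ 2.
Proof.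
move=> /andP[s0 s1]; rewrite -subr_ge0.
have -> : (1 - s) * x ^+ 2 + s * y ^+ 2 - ((1 - s) * x + s * y) ^+ 2 =
    s * (1 - s) * (x - y) ^+ 2 by ring.
by rewrite mulr_ge0 ?sqr_ge0// mulr_ge0 ?subr_ge0.
Qed.

(** * Coordinates of states *)

Lemma big_ord2 (V : nmodType) (f : 'I_2 -> V) : \sum_i f i = f 0 + f 1.
Proof.
by rewrite big_ord_recl big_ord1; congr (_ + f _); exact: val_inj.
Qed.

Lemma ucompD (R : realType) (X Y : 'cV[R]_2) :
  ucomp (X + Y) = ucomp X + ucomp Y.
Proof. by rewrite /ucomp mxE. Qed.

Lemma ucompN (R : realType) (X : 'cV[R]_2) : ucomp (- X) = - ucomp X.
Proof. by rewrite /ucomp mxE. Qed.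

Lemma ucompZ (R : realType) (c : R) (X : 'cV[R]_2) :
  ucomp (c *: X) = c * ucomp X.
Proof. by rewrite /ucomp mxE. Qed.

Lemma ucomp_col2 (R : realType) (x y : R) : ucomp (col2 x y) = x.
Proof. by rewrite /ucomp mxE. Qed.

Lemma vcompD (R : realType) (X Y : 'cV[R]_2) :
  vcomp (X + Y) = vcomp X + vcomp Y.
Proof. by rewrite /vcomp mxE. Qed.

Lemma vcompN (R : realType) (X : 'cV[R]_2) : vcomp (- X) = - vcomp X.
Proof. by rewrite /vcomp mxE. Qed.

Lemma vcompZ (R : realType) (c : R) (X : 'cV[R]_2) :
  vcomp (c *: X) = c * vcomp X.
Proof. by rewrite /vcomp mxE. Qed.

Lemma vcomp_col2 (R : realType) (x y : R) : vcomp (col2 x y) = y.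
Proof. by rewrite /vcomp mxE. Qed.

Lemma ucompB (R : realType) (X Y : 'cV[R]_2) :
  ucomp (X - Y) = ucomp X - ucomp Y.
Proof. by rewrite ucompD ucompN. Qed.

Lemma vcompB (R : realType) (X Y : 'cV[R]_2) :
  vcomp (X - Y) = vcomp X - vcomp Y.
Proof. by rewrite vcompD vcompN. Qed.

Lemma wdevB (R : realType) (a : R) (X Y : 'cV[R]_2) :
  wdev a (X - Y) = wdev a X - wdev a Y.
Proof. by rewrite /wdev ucompB vcompB; ring. Qed.

Definition compE := (ucompD, ucompN, ucompZ, ucomp_col2,
                     vcompD, vcompN, vcompZ, vcomp_col2).

(** * Entropy and Riemann invariants *)

(** The Riemann invariant of the transport system that is carried to the right,
    with speed lam (not normalised). *)
Definition riemann_right (R : realType) (lam : R) (E : 'cV[R]_2) : R :=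
  lam * ucomp E + vcomp E.

(** The Riemann invariant that is carried to the left, with speed - lam. *)
Definition riemann_left (R : realType) (lam : R) (E : 'cV[R]_2) : R :=
  lam * ucomp E - vcomp E.

Lemma riemann_rightB (R : realType) (lam : R) (X Y : 'cV[R]_2) :
  riemann_right lam (X - Y) = riemann_right lam X - riemann_right lam Y.
Proof. by rewrite /riemann_right ucompB vcompB; ring. Qed.

Lemma riemann_leftB (R : realType) (lam : R) (X Y : 'cV[R]_2) :
  riemann_left lam (X - Y) = riemann_left lam X - riemann_left lam Y.
Proof. by rewrite /riemann_left ucompB vcompB; ring. Qed.

Lemma quad_formE (R : realType) (a lam : R) (E : 'cV[R]_2) :
  quad_form (matH a lam) E =
  (lam ^+ 2 - a ^+ 2) * ucomp E ^+ 2 + wdev a E ^+ 2.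
Proof.
rewrite /quad_form !mxE big_ord2 /= !mxE !big_ord2 /= !mxE /=.
by rewrite /wdev /ucomp /vcomp; ring.
Qed.

Lemma quad_form_riemann (R : realType) (a lam : R) (E : 'cV[R]_2) :
  0 < lam ->
  quad_form (matH a lam) E =
  (lam - a) / (2 * lam) * riemann_right lam E ^+ 2
  + (lam + a) / (2 * lam) * riemann_left lam E ^+ 2.
Proof.
move=> lam0; rewrite quad_formE /riemann_right /riemann_left /wdev.
move: (ucomp E) (vcomp E) => x y; field.
by rewrite gt_eqF.
Qed.

(** * The transport half step *)

Lemma fluxFE (R : realType) (lam : R) (X : 'cV[R]_2) :
  fluxF lam X = col2 (vcomp X) (lam ^+ 2 * ucomp X).
Proof.
apply/colP => i; rewrite /fluxF /matA /ucomp /vcomp !mxE.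
rewrite big_ord2 !mxE /=.
by case: i => -[|[|//]] ? /=; ring.
Qed.

Lemma riemann_right_half_step (R : realType) (lam sigma : R)
  (U : int -> 'cV[R]_2) j :
  riemann_right lam (half_step lam sigma U j) =
  (1 - lam * sigma) * riemann_right lam (U j)
  + lam * sigma * riemann_right lam (U (j - 1)).
Proof.
rewrite /riemann_right /half_step /num_flux_sys subrK !fluxFE !compE; by field.
Qed.

Lemma riemann_left_half_step (R : realType) (lam sigma : R)
  (U : int -> 'cV[R]_2) j :
  riemann_left lam (half_step lam sigma U j) =
  (1 - lam * sigma) * riemann_left lam (U j)
  + lam * sigma * riemann_left lam (U (j + 1)).
Proof.
rewrite /riemann_left /half_step /num_flux_sys subrK !fluxFE !compE; by field.
Qed.

(** On equilibrium states the first component of the half step is the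
    limiting scheme. *)
Lemma ucomp_half_step_equilibrium (R : realType) (a lam sigma : R)
  (u : int -> R) j :
  ucomp (half_step lam sigma (fun i => equilibrium a (u i)) j) =
  u j - sigma * (num_flux_lim a lam u j - num_flux_lim a lam u (j - 1)).
Proof.
rewrite /half_step /num_flux_sys /num_flux_lim subrK !fluxFE.
rewrite /equilibrium !compE.
by field.
Qed.

(** The consistency defect of the limiting scheme with respect to the full
    system. *)
Lemma wdev_half_step_equilibrium (R : realType) (a lam sigma : R)
  (u : int -> R) j :
  wdev a (half_step lam sigma (fun i => equilibrium a (u i)) j) =
  - (sigma / 2 * (lam ^+ 2 - a ^+ 2) * (u (j + 1) - u (j - 1))).
Proof.
rewrite /wdev /half_step /num_flux_sys subrK !fluxFE /equilibrium !compE.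
by field.
Qed.

(** * Decay of the relative entropy *)

(** Local form of the entropy estimate: [P] and [M] are the contributions of
    the two Riemann invariants to the entropy density at time n, and the cost
    of the consistency defect in cell j is at most D_j + D_(j-1). *)
Lemma entropy_density_step (R : realType) (a lam eps dx dt : R)
  (U : nat -> int -> 'cV[R]_2) (ubar : nat -> int -> R) n j :
  0 < lam -> `|a| < lam -> 0 < eps -> 0 < dx -> 0 < dt ->
  lam * (dt / dx) <= 1 ->
  lie_splitting a lam eps dx dt U ->
  limiting_scheme a lam dx dt ubar ->
  let s := lam * (dt / dx) in
  let E := fun i : int => U n i - equilibrium a (ubar n i) in
  let P := fun i : int =>
    (lam - a) / (2 * lam) * riemann_right lam (E i) ^+ 2 in
  let M := fun i : int =>
    (lam + a) / (2 * lam) * riemann_left lam (E i) ^+ 2 in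
  let D := fun i : int =>
    eps * (lam ^+ 2 - a ^+ 2) ^+ 2 * dt / 4
    * ((ubar n (i + 1) - ubar n i) / dx) ^+ 2 in
  is_true (quad_form (matH a lam) (U n.+1 j - equilibrium a (ubar n.+1 j)) <=
    ((1 - s) * P j + s * P (j - 1)) + ((1 - s) * M j + s * M (j + 1))
    + (D j + D (j - 1))).
Proof.
move=> lam0 alam eps0 dx0 dt0 s1 hU hu s E P M D.
have /andP[a1 a2] : - lam < a < lam by rewrite -ltr_norml.
have s01 : 0 <= s <= 1 by rewrite s1 mulr_ge0 ?divr_ge0 ?ltW.
pose t := dt / eps.
have t0 : 0 < t by rewrite divr_gt0.
pose g := dt / dx / 2 * (lam ^+ 2 - a ^+ 2) * (ubar n (j + 1) - ubar n (j - 1)).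
(* [X1] and [X2] are the transported states before relaxation.  They are
   introduced through equations so that rewriting does not unfold the half
   step. *)
pose S := half_step lam (dt / dx).
have [X1 X1E] : exists X1, X1 = S (U n) j.
  exact: (ex_intro _ _ erefl).
have [X2 X2E] : exists X2, X2 = S (fun i => equilibrium a (ubar n i)) j.
  exact: (ex_intro _ _ erefl).
pose X := X1 - X2.
set Y := U n.+1 j - _.
have Uu : ucomp (U n.+1 j) = ucomp X1.
  by rewrite hU ucompD ucompZ ucomp_col2 mulr0 addr0 X1E.
have X2u : ucomp X2 = ubar n.+1 j.
  by rewrite X2E hu ucomp_half_step_equilibrium.
have X2w : wdev a X2 = - g by rewrite X2E wdev_half_step_equilibrium.
have XYu : ucomp Y = ucomp X by rewrite !ucompB Uu X2u ucomp_col2.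
have XYw : (1 + t) * wdev a Y = wdev a X - g.
  have U1w : (1 + t) * wdev a (U n.+1 j) = wdev a X1.
    have Uv := congr1 (@vcomp R) (hU n j).
    rewrite vcompD vcompZ vcomp_col2 -/t -/(S _ _) -X1E in Uv.
    by rewrite /wdev -Uu -[vcomp X1](addrK
         (t * (a * ucomp (U n.+1 j) - vcomp (U n.+1 j)))) -Uv; ring.
  rewrite !wdevB X2w -U1w opprK addrK.
  by rewrite [wdev a (equilibrium _ _)]/wdev ucomp_col2 vcomp_col2 subrr subr0.
have rightX : riemann_right lam X =
    (1 - s) * riemann_right lam (E j) + s * riemann_right lam (E (j - 1)).
  have X1r := riemann_right_half_step lam (dt / dx) (U n) j.
  have X2r :=
    riemann_right_half_step lam (dt / dx) (fun i => equilibrium a (ubar n i)) j.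
  rewrite -/S -X1E in X1r; rewrite -/S -X2E in X2r.
  by rewrite !riemann_rightB X1r X2r -/s; ring.
have leftX : riemann_left lam X =
    (1 - s) * riemann_left lam (E j) + s * riemann_left lam (E (j + 1)).
  have X1r := riemann_left_half_step lam (dt / dx) (U n) j.
  have X2r :=
    riemann_left_half_step lam (dt / dx) (fun i => equilibrium a (ubar n i)) j.
  rewrite -/S -X1E in X1r; rewrite -/S -X2E in X2r.
  by rewrite !riemann_leftB X1r X2r -/s; ring.
(* The difference of the two sides is a multiple of the square of the second
   difference of [ubar n]: (x - z)^2 <= 2 ((x - y)^2 + (y - z)^2). *)
have gD : g ^+ 2 / (2 * t) <= D j + D (j - 1).
  rewrite /D subrK /g.
  set x := ubar n (j + 1); set y := ubar n j; set z := ubar n (j - 1).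
  rewrite -subr_ge0.
  rewrite (_ : _ - _ = eps * (lam ^+ 2 - a ^+ 2) ^+ 2 * dt / 8 / dx ^+ 2
                       * (x - 2 * y + z) ^+ 2).
    rewrite mulr_ge0 ?sqr_ge0 // divr_ge0 ?sqr_ge0 // divr_ge0 //.
    by rewrite mulr_ge0 ?(ltW dt0) // mulr_ge0 ?sqr_ge0 ?(ltW eps0).
  by rewrite /t; field; rewrite !gt_eqF.
rewrite quad_formE XYu.
apply: (@le_trans _ _ (quad_form (matH a lam) X + g ^+ 2 / (2 * t))).
  by rewrite quad_formE -addrA lerD2l; apply: square_relaxed_le.
apply: lerD => //; rewrite quad_form_riemann // rightX leftX.
have cvx b x y : 0 <= b -> b / (2 * lam) * ((1 - s) * x + s * y) ^+ 2 <=
    (1 - s) * (b / (2 * lam) * x ^+ 2) + s * (b / (2 * lam) * y ^+ 2).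
  move=> b0; rewrite ![_ * (b / _ * _)]mulrCA -mulrDr ler_wpM2l //.
    by rewrite divr_ge0 // mulr_ge0 // ltW.
  exact: square_convex_le.
by apply: lerD; apply: cvx; lra.
Qed.

(** Sum over the cells of the local estimate. *)
Lemma rel_entropy_step (R : realType) (a lam eps dx dt : R)
  (U : nat -> int -> 'cV[R]_2) (ubar : nat -> int -> R) n :
  0 < lam -> `|a| < lam -> 0 < eps -> 0 < dx -> 0 < dt ->
  lam * (dt / dx) <= 1 ->
  lie_splitting a lam eps dx dt U ->
  limiting_scheme a lam dx dt ubar ->
  (rel_entropy a lam dx (U n.+1) (fun j => equilibrium a (ubar n.+1 j)) <=
   rel_entropy a lam dx (U n) (fun j => equilibrium a (ubar n j))
   + (eps * (lam ^+ 2 - a ^+ 2) ^+ 2 / 4)%:E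
     * ((dt * dx)%:E
        * sumZ (fun j => (((ubar n (j + 1) - ubar n j) / dx) ^+ 2)%R)))%E.
Proof.
move=> lam0 alam eps0 dx0 dt0 s1 hU hu.
have /andP[a1 a2] : - lam < a < lam by rewrite -ltr_norml.
pose s := lam * (dt / dx).
pose E i := U n i - equilibrium a (ubar n i).
pose P i := (lam - a) / (2 * lam) * riemann_right lam (E i) ^+ 2.
pose M i := (lam + a) / (2 * lam) * riemann_left lam (E i) ^+ 2.
pose G i := ((ubar n (i + 1) - ubar n i) / dx) ^+ 2.
pose c := eps * (lam ^+ 2 - a ^+ 2) ^+ 2 * dt / 4.
have s0 : 0 <= s by rewrite mulr_ge0 ?divr_ge0 ?ltW.
have s1' : 0 <= 1 - s by rewrite subr_ge0.
have P0 i : 0 <= P i.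
  by rewrite mulr_ge0 ?sqr_ge0// divr_ge0 ?mulr_ge0//; lra.
have M0 i : 0 <= M i.
  by rewrite mulr_ge0 ?sqr_ge0// divr_ge0 ?mulr_ge0//; lra.
have c0 : 0 <= c.
  by rewrite divr_ge0 // mulr_ge0 ?(ltW dt0) // mulr_ge0 ?sqr_ge0 ?(ltW eps0).
have G0 i : 0 <= G i by exact: sqr_ge0.
(* Shifting the index leaves the sum unchanged, so that a convex combination of
   neighbouring values has the same total mass. *)
have sum_cvx (f : int -> R) k : (forall i, 0 <= f i) ->
    sumZ (fun j => (1 - s) * f j + s * f (j + k)) = sumZ f.
  move=> f0.
  rewrite sumZD => [|j|j]; [|exact: mulr_ge0..].
  rewrite (sumZ_shift (fun j => s * f j)) -sumZD => [|j|j];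
    [|exact: mulr_ge0..].
  by apply: eq_sumZ => j; rewrite -mulrDl subrK mul1r.
have sum_bound : (sumZ (fun j => quad_form (matH a lam)
       (U n.+1 j - equilibrium a (ubar n.+1 j)))
    <= sumZ (fun j => quad_form (matH a lam) (E j)) + (2 * c)%:E * sumZ G)%E.
  have -> : sumZ (fun j => quad_form (matH a lam) (E j)) = (sumZ P + sumZ M)%E.
    rewrite -sumZD //; apply: eq_sumZ => j.
    by rewrite quad_form_riemann.
  pose D j := c * G j.
  have D0 j : 0 <= D j by exact: mulr_ge0.
  apply: (@le_trans _ _ (sumZ (fun j =>
      ((1 - s) * P j + s * P (j - 1)) + ((1 - s) * M j + s * M (j + 1))
      + (D j + D (j - 1))))).
    by apply: le_sumZ => j; apply: entropy_density_step.
  rewrite sumZD => [|j|j]; last exact: addr_ge0; last first.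
    by apply: addr_ge0; apply: addr_ge0; apply: mulr_ge0.
  rewrite sumZD => [|j|j]; [|by apply: addr_ge0; apply: mulr_ge0..].
  rewrite !sum_cvx // leeD2l // sumZD //.
  rewrite (sumZ_shift D) mulrC mulr_natr mulr2n EFinD ge0_muleDl ?lee_fin //.
  by rewrite leeD // sumZ_scale_le.
rewrite /rel_entropy.
apply: le_trans.
  by apply: lee_wpmul2l sum_bound; rewrite lee_fin divr_ge0 ?ltW.
have Q0 : (0 <= sumZ (fun j => quad_form (matH a lam) (E j)))%E.
  apply: sumZ_ge0 => j; rewrite quad_formE addr_ge0 ?sqr_ge0 //.
  by rewrite mulr_ge0 ?sqr_ge0 // subr_sqr mulr_ge0; lra.
have cG0 : (0 <= (2 * c)%:E * sumZ G)%E.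
  by rewrite mule_ge0 ?sumZ_ge0 // lee_fin mulr_ge0.
rewrite ge0_muleDr //.
rewrite leeD2l // !muleA -!EFinM lee_wpmul2r ?sumZ_ge0 // lee_fin.
by rewrite le_eqVlt; apply/orP; left; apply/eqP; rewrite /c; field.
Qed.

Lemma rel_entropy_le_sum (R : realType) (a lam eps dx dt : R)
  (U : nat -> int -> 'cV[R]_2) (ubar : nat -> int -> R) N :
  0 < lam -> `|a| < lam -> 0 < eps -> 0 < dx -> 0 < dt ->
  lam * (dt / dx) <= 1 ->
  lie_splitting a lam eps dx dt U ->
  limiting_scheme a lam dx dt ubar ->
  (rel_entropy a lam dx (U N) (fun j => equilibrium a (ubar N j)) <=
   rel_entropy a lam dx (U 0%N) (fun j => equilibrium a (ubar 0%N j))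
   + (eps * (lam ^+ 2 - a ^+ 2) ^+ 2 / 4)%:E
     * \sum_(0 <= n < N) ((dt * dx)%:E
        * sumZ (fun j => (((ubar n (j + 1) - ubar n j) / dx) ^+ 2)%R)))%E.
Proof.
move=> lam0 alam eps0 dx0 dt0 s1 hU hu.
have term0 n : (0 <= (dt * dx)%:E
    * sumZ (fun j => (((ubar n (j + 1) - ubar n j) / dx) ^+ 2)%R))%E.
  apply: mule_ge0; first by rewrite lee_fin ltW ?mulr_gt0.
  by apply: sumZ_ge0 => j; exact: sqr_ge0.
elim: N => [|N IH]; first by rewrite big_nil mule0 adde0.
rewrite big_nat_recr //= ge0_muleDr ?sume_ge0 // addeA.
exact: le_trans (rel_entropy_step _ _ _ _ _ _ _ hU hu) (leeD2r _ IH).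
Qed.

Theorem theorem2 (R : realType) (a lam : R) (lam_gt0 : 0 < lam)
  (a_lt_lam : `|a| < lam) :
  exists theta0 : R, 0 < theta0 < 1 /\
  forall (eps dx dt T : R) (U : nat -> int -> 'cV[R]_2) (ubar : nat -> int -> R),
  0 < eps -> 0 < dx -> 0 < dt -> 0 < T ->
  lam * (dt / dx) <= theta0 ->
  lie_splitting a lam eps dx dt U ->
  limiting_scheme a lam dx dt ubar ->
  let Ubar := fun (n : nat) (j : int) => equilibrium a (ubar n j) in
  let w := fun (n : nat) (j : int) => wdev a (U n j) in
  let Phi := fun n : nat => rel_entropy a lam dx (U n) (Ubar n) in
  (Phi 0%N < +oo)%E ->
  (exists um up : R, forall n : nat,
     [/\ lim_ninfty (U n) (equilibrium a um),
         lim_pinfty (U n) (equilibrium a up),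
         lim_ninfty (Ubar n) (equilibrium a um) &
         lim_pinfty (Ubar n) (equilibrium a up)]) ->
  forall K : R, 0 < K ->
  (forall N : nat, N%:R * dt <= T ->
     (\sum_(0 <= n < N)
        (dt * dx)%:E * sumZ (fun j : int => (((ubar n (j + 1) - ubar n j) / dx) ^+ 2)%R)
      <= (K ^+ 2)%:E)%E) ->
  forall N : nat, N%:R * dt <= T ->
    (Phi N <= Phi 0%N
       + (dt / (2 * eps) * dx)%:E * sumZ (fun j : int => (w 0%N j ^+ 2)%R)
       + (dt ^+ 2 / (2 * eps ^+ 2) * dx)%:E * sumZ (fun j : int => (w 0%N j ^+ 2)%R)
       + (eps * (lam ^+ 2 - a ^+ 2) ^+ 2 / 2 * K ^+ 2)%:E)%E.
Proof.
(* Any bound in ]0, 1[ works, as transport contracts as soon as s <= 1. *)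
exists (1 / 2); split; first lra.
move=> eps dx dt T U ubar eps0 dx0 dt0 _ cfl hU hu Ubar w Phi _ _ K K0 hK N NT.
have w0 (c : R) : 0 <= c ->
    (0 <= c%:E * sumZ (fun j : int => (w 0%N j ^+ 2)%R))%E.
  move=> c0; apply: mule_ge0; first by rewrite lee_fin.
  by apply: sumZ_ge0 => j; exact: sqr_ge0.
have cfl1 : lam * (dt / dx) <= 1 by lra.
apply: le_trans.
  exact: (rel_entropy_le_sum N lam_gt0 a_lt_lam eps0 dx0 dt0 cfl1 hU hu).
apply: leeD.
  rewrite -addeA leeDl // adde_ge0 // w0 // ltW //.
    by rewrite mulr_gt0 ?divr_gt0 ?mulr_gt0.
  by rewrite mulr_gt0 ?divr_gt0 ?mulr_gt0 ?exprn_gt0.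
apply: le_trans.
  apply: lee_wpmul2l (hK N NT).
  by rewrite lee_fin divr_ge0 // mulr_ge0 ?sqr_ge0 ?(ltW eps0).
rewrite -EFinM lee_fin ler_wpM2r ?sqr_ge0 // ler_wpM2l //; last lra.
by rewrite mulr_ge0 ?sqr_ge0 ?ltW.
Qed.
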